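(* Let $\dim\mathcal H\ge2$, $C_i\in\mathrm{Sym}^+(\mathcal H)$ ($i=1,\dots,N$), weights $w_i>0$ with $\sum_iw_i=1$, $\epsilon>0$, $c_\epsilon=4/\epsilon$. Each of the following equations has, besides the trivial solution $X=0$, uncountably infinitely many positive singular (non-injective) solutions $X\in\mathrm{Sym}^+(\mathcal H)$: (1) $X=\sum_iw_i(X^{1/2}C_iX^{1/2})^{1/2}$, under the hypothesis $\sum_iw_iC_i>0$; without this hypothesis it still has at least one nonzero positive singular solution. (2) $X=\frac1{c_\epsilon}\sum_iw_i\big[-I+(I+c_\epsilon^2X^{1/2}C_iX^{1/2})^{1/2}\big]$, under the hypotheses $2\le\dim\mathcal H<\infty$ and $0<\epsilon I<2\sum_iw_iC_i$. (3) $X=\frac1{c_\epsilon}\big[-I+\big(\sum_iw_i(I+c_\epsilon^2X^{1/2}C_iX^{1/2})^{1/2}\big)^2\big]^{1/2}$, under the hypothesis $\sum_iw_iC_i>0$; without this hypothesis it still has at least one nonzero positive singular solution. More precisely, in (1), for every unit vector $u$ with $\sum_iw_i\langle u,C_iu\rangle^{1/2}>0$, $X_u=\big(\sum_iw_i\langle u,C_iu\rangle^{1/2}\big)^2(u\otimes u)$ is a solution; in (2) and (3), solutions of the form $X_u=x_u(u\otimes u)$ with $x_u>0$ exist for every unit $u$ with $\epsilon<2\sum_iw_i\langle u,C_iu\rangle$ (case 2), respectively $\sum_iw_i\langle u,C_iu\rangle>0$ (case 3).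
   Context: $\mathcal H$ real separable Hilbert space; $\mathrm{Sym}^+(\mathcal H)$ positive bounded self-adjoint operators; for self-adjoint $A,B$, $A<B$ means $B-A$ strictly positive and $T>0$ means $\langle Tx,x\rangle>0$ for all $x\ne0$. For $u\in\mathcal H$, $u\otimes u$ is the rank-one operator $x\mapsto\langle u,x\rangle u$.
   Formalization: In (1) and (3), the claim of a nonzero positive singular solution without the hypothesis ΣwᵢCᵢ>0 is stated assuming some Cᵢ≠0, since if all Cᵢ=0 the only solution is X=0; that the trivial X=0 is itself a solution is not restated. *)

(* Defs.v *)
From HB Require Import structures.
From mathcomp Require Import all_boot all_order all_algebra.
From mathcomp Require Import all_classical all_reals all_analysis.
Set Implicit Arguments. Unset Strict Implicit. Unset Printing Implicit Defensive.
Import Order.TTheory GRing.Theory Num.Theory.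
Import numFieldNormedType.Exports.
Local Open Scope classical_set_scope.
Local Open Scope ring_scope.

Section HilbertDefs.
Variables (R : realType) (H : completeNormedModType R) (ip : H -> H -> R).

Definition is_real_sep_hilbert : Prop :=
  [/\ (forall x y, ip x y = ip y x),
      (forall (a : R) (x y z : H), ip (a *: x + y) z = a * ip x z + ip y z),
      (forall x, ip x x = `|x| ^+ 2) &
      (exists D : set H, countable D /\ closure D = setT)].

Definition dim_ge2 : Prop :=
  exists u v : H, [/\ ip u u = 1, ip v v = 1 & ip u v = 0].

Definition is_linear_op (T : H -> H) : Prop :=
  forall (a : R) (x y : H), T (a *: x + y) = a *: T x + T y.

Definition is_bounded_op (T : H -> H) : Prop :=
  exists M : R, forall x, `|T x| <= M * `|x|.

Definition is_selfadjoint (T : H -> H) : Prop :=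
  forall x y, ip (T x) y = ip x (T y).

Definition SymPos (T : H -> H) : Prop :=
  [/\ is_linear_op T, is_bounded_op T, is_selfadjoint T &
      forall x, 0 <= ip (T x) x].

Definition strictly_pos (T : H -> H) : Prop :=
  forall x, x <> 0 -> 0 < ip (T x) x.

Definition unit_vec (u : H) : Prop := ip u u = 1.

Definition rank1 (u : H) : H -> H := fun x => ip u x *: u.

Definition idop : H -> H := fun x => x.
Definition zeroop : H -> H := fun _ => 0.

Definition opsum (N : nat) (w : 'I_N -> R) (F : 'I_N -> H -> H) : H -> H :=
  fun x => \sum_(i < N) w i *: F i x.

Definition is_psqrt (A S : H -> H) : Prop := SymPos S /\ (S \o S = A).

(* A^{1/2}: the (unique) positive square root of A (defined by choice;
   default 0 if none exists, which never happens for A in Sym^+) *)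
Definition psqrt (A : H -> H) : H -> H :=
  match pselect (exists S, is_psqrt A S) with
  | left h => projT1 (cid h)
  | right _ => zeroop
  end.

Definition sandwich (X C : H -> H) : H -> H := psqrt X \o C \o psqrt X.

Definition pos_singular (X : H -> H) : Prop :=
  [/\ SymPos X, X <> zeroop & ~ injective X].

Definition eq1 N (w : 'I_N -> R) (C : 'I_N -> H -> H) (X : H -> H) : Prop :=
  X = opsum w (fun i => psqrt (sandwich X (C i))).

Definition shifted (c : R) (X C : H -> H) : H -> H :=
  fun x => x + (c ^+ 2) *: sandwich X C x.

Definition eq2 N (w : 'I_N -> R) (C : 'I_N -> H -> H) (c : R) (X : H -> H) : Prop :=
  X = (fun x => c^-1 *:
         opsum w (fun i y => - y + psqrt (shifted c X (C i)) y) x).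

Definition eq3 N (w : 'I_N -> R) (C : 'I_N -> H -> H) (c : R) (X : H -> H) : Prop :=
  let T := opsum w (fun i => psqrt (shifted c X (C i))) in
  X = (fun x => c^-1 *: psqrt (fun y => - y + T (T y)) x).

End HilbertDefs.

Definition finite_dim {R : realType} (H : completeNormedModType R) : Prop :=
  exists (n : nat) (e : 'I_n -> H),
    forall x : H, exists a : 'I_n -> R, x = \sum_(i < n) a i *: e i.

(* Main.v *)
Require Import Defs.
From HB Require Import structures.
From mathcomp Require Import all_boot all_order all_algebra.
From mathcomp Require Import all_classical all_reals all_analysis.
From mathcomp Require Import ring lra.
Set Implicit Arguments.
Unset Strict Implicit.
Unset Printing Implicit Defensive.
Import Order.TTheory GRing.Theory Num.Theory.
Import numFieldNormedType.Exports.
Local Open Scope classical_set_scope.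
Local Open Scope ring_scope.

(** On a rank-one operator [X = x (u (x) u)] every operator in the equations has
    the form [b I + a (u (x) u)], so each equation becomes one scalar equation
    in [x].  A positive square root [S] of such an operator is unique: if
    [S^2 v = l v], then [y = S v - sqrt l v] satisfies [S y = - sqrt l y], which
    forces [y = 0], so [S] is determined on [u] and on its orthogonal
    complement.  After division by [x], the scalar equations for (2) and (3) are
    solved by the intermediate value theorem.  Letting [u] run through the unit
    multiples of [e + t f], [t] real, with [e] and [f] orthonormal, gives
    uncountably many solutions. *)

(** * Geometry of the inner product *)

Section InnerProduct.
Context {R : realType} {H : completeNormedModType R} {ip : H -> H -> R}.
Hypothesis hH : is_real_sep_hilbert ip.

Lemma ipC x y : ip x y = ip y x.
Proof. by case: hH => + _ _ _; apply. Qed.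

Lemma ip_norm x : ip x x = `|x| ^+ 2.
Proof. by case: hH => _ _ + _; apply. Qed.

Lemma ipDl x y z : ip (x + y) z = ip x z + ip y z.
Proof. by case: hH => _ /(_ 1 x y z) + _ _; rewrite scale1r mul1r. Qed.

Lemma ip0l z : ip 0 z = 0.
Proof. by apply: (addIr (ip 0 z)); rewrite -ipDl addr0 add0r. Qed.

Lemma ipZl a x z : ip (a *: x) z = a * ip x z.
Proof. by case: hH => _ /(_ a x 0 z) + _ _; rewrite addr0 ip0l addr0. Qed.

Lemma ipDr x y z : ip z (x + y) = ip z x + ip z y.
Proof. by rewrite !(ipC z) ipDl. Qed.

Lemma ipZr a x z : ip z (a *: x) = a * ip z x.
Proof. by rewrite !(ipC z) ipZl. Qed.

Lemma ipNl x z : ip (- x) z = - ip x z.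
Proof. by rewrite -scaleN1r ipZl mulN1r. Qed.

Lemma ipNr x z : ip z (- x) = - ip z x.
Proof. by rewrite !(ipC z) ipNl. Qed.

Lemma ip_sumr (N : nat) (w : 'I_N -> R) (F : 'I_N -> H) z :
  ip z (\sum_(i < N) w i *: F i) = \sum_(i < N) w i * ip z (F i).
Proof.
elim/big_ind2: _ => [|x a y b <- <-|i _]; first by rewrite ipC ip0l.
  by rewrite ipDr.
by rewrite ipZr.
Qed.

Lemma ip_ge0 x : 0 <= ip x x.
Proof. by rewrite ip_norm sqr_ge0. Qed.

Lemma ip_le0_eq0 x : ip x x <= 0 -> x = 0.
Proof.
move=> le0; apply/normr0_eq0/eqP; rewrite -sqrf_eq0 -ip_norm.
by rewrite eq_le le0 ip_ge0.
Qed.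

Definition ipE := (ipDl, ipDr, ipZl, ipZr, ipNl, ipNr).

Lemma unit_vec_neq0 u : unit_vec ip u -> u <> 0.
Proof.
move=> hu u0; move: hu; rewrite /unit_vec u0 ip0l => /eqP.
by rewrite eq_sym oner_eq0.
Qed.

Lemma unit_normalize v : v <> 0 -> unit_vec ip (`|v|^-1 *: v).
Proof.
move=> /eqP v0; rewrite /unit_vec !ipE ip_norm.
by rewrite mulrA -expr2 -exprMn mulVf ?normr_eq0// expr1n.
Qed.

(** Cauchy-Schwarz against a unit vector: the difference of the two sides is the squared norm of the
    component of [x] orthogonal to [u]. *)
Lemma sqr_ip_unit_le u x : unit_vec ip u -> ip u x ^+ 2 <= ip x x.
Proof.
move=> hu; have := ip_ge0 (x - ip u x *: u).
rewrite !ipE hu (ipC x u); nra.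
Qed.

Lemma ip_unit_le u x : unit_vec ip u -> `|ip u x| <= `|x|.
Proof.
move=> hu; rewrite -(ler_pXn2r (n := 2)) ?nnegrE//.
rewrite real_normK ?num_real// -ip_norm; exact: sqr_ip_unit_le.
Qed.

(** * Operators [b I + a (u (x) u)] and their positive square roots *)

Lemma linear_op0 (T : H -> H) : is_linear_op T -> T 0 = 0.
Proof.
move=> Tlin; apply: (addIr (T 0)); rewrite add0r -{1}(scale1r (T 0)) -Tlin.
by rewrite scale1r addr0.
Qed.

Lemma linear_opZ (T : H -> H) (k : R) x :
  is_linear_op T -> T (k *: x) = k *: T x.
Proof. by move=> Tlin; rewrite -{1}(addr0 (k *: x)) Tlin linear_op0// addr0. Qed.

(** For unit [u] the eigenvalues are [b + a] on [u] and [b] on its orthogonal complement; hence the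
    conditions [0 <= b] and [0 <= b + a] below. *)
Definition scalar_rank1 (b a : R) (u : H) : H -> H :=
  fun y => b *: y + a *: rank1 ip u y.

Lemma scalar_rank1_SymPos (b a : R) u : unit_vec ip u -> 0 <= b -> 0 <= b + a ->
  SymPos ip (scalar_rank1 b a u).
Proof.
move=> hu b0 ba0; split.
- move=> k x y; rewrite /scalar_rank1 /rank1 !ipE scalerDl !scalerDr.
  by rewrite addrACA !scalerA [b * k]mulrC mulrCA mulrA.
- exists (`|b| + `|a|) => x; rewrite /scalar_rank1 /rank1.
  apply: (le_trans (ler_normD _ _)); rewrite mulrDl !normrZ.
  have -> : `|u| = 1.
    by apply/eqP; rewrite -(eqrXn2 (n := 2))// expr1n -ip_norm hu.
  by rewrite mulr1 lerD2l ler_wpM2l// ip_unit_le.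
- move=> x y; rewrite /scalar_rank1 /rank1 !ipE (ipC x u); ring.
- move=> x; rewrite /scalar_rank1 /rank1 !ipE.
  (* The quadratic form splits into the two eigenspaces, each weighted by its eigenvalue. *)
  rewrite (_ : b * _ + _ = b * (ip x x - ip u x ^+ 2) + (b + a) * ip u x ^+ 2);
    last by ring.
  apply: addr_ge0; apply: mulr_ge0; rewrite ?sqr_ge0// subr_ge0.
  exact: sqr_ip_unit_le.
Qed.

Lemma sym_pos_sqrt_eigen S (l : R) v : SymPos ip S -> 0 <= l ->
  S (S v) = l *: v -> S v = Num.sqrt l *: v.
Proof.
move=> [Slin _ Ssa Spos] l0 SSv.
have [l_eq0|l_neq0] := eqVneq l 0.
  (* Here [<S v, S v> = <v, S (S v)> = 0]; the argument for [l > 0] divides by [sqrt l]. *)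
  rewrite l_eq0 sqrtr0 scale0r; apply: ip_le0_eq0.
  by rewrite Ssa SSv l_eq0 scale0r ipC ip0l.
set y := S v - Num.sqrt l *: v.
have Sy : S y = - Num.sqrt l *: y.
  rewrite /y -scaleNr addrC Slin SSv scalerDr scalerA mulrNN -expr2.
  by rewrite sqr_sqrtr// addrC.
have s0 : 0 < Num.sqrt l by rewrite sqrtr_gt0 lt_neqAle eq_sym l_neq0.
have : 0 <= ip (S y) y by [].
rewrite Sy ipZl mulNr oppr_ge0 pmulr_rle0// => yy.
by apply/eqP; rewrite -subr_eq0; apply/eqP; exact: ip_le0_eq0.
Qed.

Lemma scalar_rank1_comp b1 a1 b2 a2 u : unit_vec ip u ->
  scalar_rank1 b1 a1 u \o scalar_rank1 b2 a2 u =
  scalar_rank1 (b1 * b2) (b1 * a2 + a1 * b2 + a1 * a2) u.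
Proof.
move=> hu; apply/funext => x; rewrite /= /scalar_rank1 /rank1 !ipE hu mulr1.
rewrite !scalerDr !scalerA -addrA; congr (_ + _).
by rewrite -scalerDl; congr (_ *: _); ring.
Qed.

Lemma psqrt_scalar_rank1 (b a : R) u : unit_vec ip u -> 0 <= b -> 0 <= b + a ->
  psqrt ip (scalar_rank1 b a u) =
  scalar_rank1 (Num.sqrt b) (Num.sqrt (b + a) - Num.sqrt b) u.
Proof.
move=> hu b0 ba0.
(* Exhibiting one root rules out the default value of [psqrt]; any root chosen by it is then
   computed on [u] and on the component orthogonal to [u]. *)
rewrite /psqrt; case: pselect => [h|[]]; last first.
  exists (scalar_rank1 (Num.sqrt b) (Num.sqrt (b + a) - Num.sqrt b) u); split.
    apply: scalar_rank1_SymPos => //.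
    by rewrite addrC subrK sqrtr_ge0.
  rewrite scalar_rank1_comp//; congr (scalar_rank1 _ _ _).
    by rewrite -expr2 sqr_sqrtr.
  rewrite (_ : _ + _ = Num.sqrt (b + a) ^+ 2 - Num.sqrt b ^+ 2); last by ring.
  by rewrite !sqr_sqrtr// addrAC subrr add0r.
case: (cid h) => S [SP SS] /=; apply/funext => x.
have [Slin _ _ _] := SP.
have Su : S u = Num.sqrt (b + a) *: u.
  apply: sym_pos_sqrt_eigen => //.
  rewrite -[S (S u)]/((S \o S) u) SS /scalar_rank1 /rank1 hu scale1r.
  by rewrite -scalerDl.
have Sx : S (x - ip u x *: u) = Num.sqrt b *: (x - ip u x *: u).
  apply: sym_pos_sqrt_eigen => //.
  rewrite -[S (S _)]/((S \o S) _) SS /scalar_rank1 /rank1 !ipE hu mulr1 subrr.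
  by rewrite scale0r scaler0 addr0.
rewrite -{1}(subrK (ip u x *: u) x) addrC Slin Su Sx /scalar_rank1 /rank1.
rewrite scalerBr !scalerA addrCA; congr (_ + _).
by rewrite -scalerBl; congr (_ *: _); ring.
Qed.

Lemma scalar_rank1_0 a u : scalar_rank1 0 a u = fun x => a *: rank1 ip u x.
Proof. by apply/funext => x; rewrite /scalar_rank1 scale0r add0r. Qed.

Lemma psqrt_rank1 (a : R) u : unit_vec ip u -> 0 <= a ->
  psqrt ip (fun x => a *: rank1 ip u x) = fun x => Num.sqrt a *: rank1 ip u x.
Proof.
move=> hu a0; rewrite -!scalar_rank1_0 psqrt_scalar_rank1 ?add0r//.
by rewrite sqrtr0 subr0.
Qed.

(** Both outer factors are [sqrt x] times the projection onto [u], so only [<u, C u>] survives from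
    [C]. *)
Lemma sandwich_rank1 (x : R) u C : unit_vec ip u -> 0 <= x -> SymPos ip C ->
  sandwich ip (fun y => x *: rank1 ip u y) C =
  fun y => (x * ip u (C u)) *: rank1 ip u y.
Proof.
move=> hu x0 [Clin _ _ _]; rewrite /sandwich psqrt_rank1//.
apply/funext => y /=.
rewrite /rank1 !(linear_opZ _ _ Clin) !ipZr !scalerA; congr (_ *: _).
have := sqr_sqrtr x0; set r := Num.sqrt x => <-; ring.
Qed.

Lemma psqrt_shifted_rank1 (c x : R) u C :
  unit_vec ip u -> 0 <= x -> SymPos ip C ->
  psqrt ip (shifted ip c (fun y => x *: rank1 ip u y) C) =
  scalar_rank1 1 (Num.sqrt (1 + c ^+ 2 * (x * ip u (C u))) - 1) u.
Proof.
move=> hu x0 CP.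
have uC0 : 0 <= ip u (C u) by rewrite ipC; case: CP.
rewrite (_ : shifted _ _ _ _ = scalar_rank1 1 (c ^+ 2 * (x * ip u (C u))) u).
  rewrite psqrt_scalar_rank1 ?sqrtr1//.
  by rewrite addr_ge0// mulr_ge0 ?sqr_ge0// mulr_ge0.
rewrite /shifted sandwich_rank1//; apply/funext => y.
by rewrite /scalar_rank1 scale1r scalerA.
Qed.

(** * Singularity, nonvanishing forms and uncountable families *)

Lemma exists_orthogonal u : dim_ge2 ip -> exists2 v, v <> 0 & ip u v = 0.
Proof.
move=> [e [f [he hf ef]]].
have [ue|ue] := eqVneq (ip u e) 0.
  by exists e => //; exact: unit_vec_neq0.
(* The combination of [e] and [f] killed by [<u, _>]; its [f]-coefficient [- <u, e>] is nonzero. *)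
exists (ip u f *: e - ip u e *: f); last by rewrite !ipE; ring.
move=> v0; have : ip (ip u f *: e - ip u e *: f) f = 0 by rewrite v0 ip0l.
by rewrite !ipE ef hf mulr0 mulr1 add0r => /eqP; rewrite oppr_eq0 (negPf ue).
Qed.

Lemma rank1_pos_singular (x : R) u : dim_ge2 ip -> unit_vec ip u -> 0 < x ->
  pos_singular ip (fun y => x *: rank1 ip u y).
Proof.
move=> hdim hu x0; split.
- by rewrite -scalar_rank1_0; apply: scalar_rank1_SymPos; rewrite ?add0r// ltW.
- move=> /(congr1 (@^~ u)) /=; rewrite /zeroop /rank1 hu scale1r => /eqP.
  rewrite scaler_eq0 gt_eqF//= => /eqP; exact: unit_vec_neq0.
- have [v v0 uv] := exists_orthogonal u hdim.
  by move=> inj; apply: v0; apply: inj; rewrite /rank1 uv (ipC u) ip0l.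
Qed.

Lemma SymPos_form_gt0 C : SymPos ip C -> C <> @zeroop R H ->
  exists2 u, unit_vec ip u & 0 < ip u (C u).
Proof.
move=> [Clin _ Csa Cpos] C0; apply: contrapT => nex; apply: C0.
have CDr x y : C (x + y) = C x + C y by rewrite -{1}(scale1r x) Clin scale1r.
have form0 x : ip (C x) x = 0.
  have [->|/eqP x0] := eqVneq x 0; first by rewrite ipC ip0l.
  apply/eqP; rewrite eq_le Cpos andbT leNgt; apply/negP => pos.
  apply: nex; exists (`|x|^-1 *: x); first exact: unit_normalize.
  rewrite (linear_opZ _ _ Clin) !ipE (ipC x) !mulr_gt0// invr_gt0 normr_gt0; exact/eqP.
apply/funext => x; rewrite /zeroop; apply: ip_le0_eq0.
(* Polarisation: when the form vanishes everywhere, its value at [x + C x] is [2 <C x, C x>]. *)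
have := form0 (x + C x); rewrite CDr !ipE !form0 (Csa (C x)) add0r addr0.
have := ip_ge0 (C x); lra.
Qed.

(* With [X = x (u (x) u)] and [u] proportional to [e + t f], the slope [t] is
   recovered from [X] as [<X e, f> / <X e, e>]. *)
Lemma uncountable_rank1 (P : set (H -> H)) : dim_ge2 ip ->
  (forall u, unit_vec ip u ->
     exists2 x : R, 0 < x & P (fun y => x *: rank1 ip u y)) ->
  ~ countable [set X | pos_singular ip X /\ P X].
Proof.
move=> hdim hP; set A := (X in countable X) => cA.
have [e [f [he hf ef]]] := hdim.
have : countable [set: R].
  pose slope (X : H -> H) := ip (X e) f / ip (X e) e.
  (* It suffices that every real [t] is the slope of some member of [A]. *)
  apply: sub_countable cA; apply: card_le_trans (card_image_le slope A).
  apply: subset_card_le => t _.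
  have v0 : e + t *: f <> 0.
    move=> v0; have : ip (e + t *: f) e = 0 by rewrite v0 ip0l.
    by rewrite !ipE he (ipC f) ef mulr0 addr0 => /eqP; rewrite oner_eq0.
  have hu := unit_normalize v0.
  have [x x0 Px] := hP _ hu.
  exists (fun y => x *: rank1 ip (`|e + t *: f|^-1 *: (e + t *: f)) y).
    by split => //; exact: rank1_pos_singular.
  have n0 : `|e + t *: f| != 0 by rewrite normr_eq0; exact/eqP.
  rewrite /slope /rank1 !ipE he hf (ipC f) ef.
  by field; rewrite n0 gt_eqF.
(* A countable real line would have measure zero, yet it contains [[0, 1]]. *)
move=> /countable_lebesgue_measure0.
have : (lebesgue_measure (`[0%R, 1%R]%classic : set R) <=
        lebesgue_measure [set: R])%E by apply: le_measure; rewrite ?inE.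
rewrite lebesgue_measure_itv /= lte_fin ltr01 oppr0 adde0 => + A0.
by rewrite A0 lee_fin ler10.
Qed.

(** * Reduction of the three equations to scalar ones *)

Section RankOneSolutions.
Context {N : nat} {w : 'I_N -> R} {C : 'I_N -> H -> H}.
Hypothesis hC : forall i, SymPos ip (C i).

Lemma SymPos_form_ge0 i u : 0 <= ip u (C i u).
Proof. by rewrite ipC; case: (hC i). Qed.

(** With [s] the sum, the i-th root is [s * sqrt <u, C i u>] times [u (x) u], so the weighted sum
    has coefficient [s * s]. *)
Lemma eq1_rank1 u : unit_vec ip u ->
  0 <= \sum_(i < N) w i * Num.sqrt (ip u (C i u)) ->
  eq1 ip w C (fun x => (\sum_(i < N) w i * Num.sqrt (ip u (C i u))) ^+ 2
                         *: rank1 ip u x).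
Proof.
move=> hu; set s := \sum_(i < N) _ => s0; apply/funext => y.
rewrite /opsum expr2 -scalerA {1}/s scaler_suml; apply: eq_bigr => i _.
have a0 := SymPos_form_ge0 i u.
rewrite sandwich_rank1 ?sqr_ge0// psqrt_rank1 ?mulr_ge0 ?sqr_ge0//.
rewrite sqrtrM ?sqr_ge0// sqrtr_sqr ger0_norm// !scalerA.
by congr (_ *: _); ring.
Qed.

Lemma eq2_rank1 (c x : R) u : unit_vec ip u -> 0 < c -> 0 <= x ->
  c * x = \sum_(i < N) w i *
            (Num.sqrt (1 + c ^+ 2 * (x * ip u (C i u))) - 1) ->
  eq2 ip w C c (fun y => x *: rank1 ip u y).
Proof.
move=> hu c0 x0 ex; apply/funext => y.
rewrite -[x](mulKf (lt0r_neq0 c0)) ex -scalerA; congr (_ *: _).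
rewrite /opsum scaler_suml; apply: eq_bigr => i _.
rewrite -ex mulKf ?lt0r_neq0// psqrt_shifted_rank1// /scalar_rank1.
by rewrite scale1r addKr scalerA.
Qed.

(** Since the weights sum to 1, [T = I + (s - 1) (u (x) u)] with [s] the weighted sum; thus
    [T^2 - I] is [s^2 - 1 = (c x)^2] times [u (x) u]. *)
Lemma eq3_rank1 (c x : R) u : \sum_(i < N) w i = 1 ->
  unit_vec ip u -> 0 < c -> 0 <= x ->
  1 + (c * x) ^+ 2 = (\sum_(i < N) w i *
     Num.sqrt (1 + c ^+ 2 * (x * ip u (C i u)))) ^+ 2 ->
  eq3 ip w C c (fun y => x *: rank1 ip u y).
Proof.
move=> hw1 hu c0 x0; set s := \sum_(i < N) _ => ex.
rewrite /eq3 /=; set T := opsum _ _.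
have eT : T = scalar_rank1 1 (s - 1) u.
  apply/funext => y; rewrite /T /opsum /scalar_rank1 -{1}hw1 /s.
  rewrite -{2}hw1 -sumrB !scaler_suml -big_split /=; apply: eq_bigr => i _.
  rewrite psqrt_shifted_rank1// /scalar_rank1 scale1r scalerDr !scalerA.
  by congr (_ + _ *: _); ring.
rewrite (_ : (fun y => - y + T (T y)) = fun y => (c * x) ^+ 2 *: rank1 ip u y).
  rewrite psqrt_rank1 ?sqr_ge0// sqrtr_sqr ger0_norm;
    last by rewrite mulr_ge0// ltW.
  by apply/funext => y; rewrite [RHS]scalerA mulKf// lt0r_neq0.
apply/funext => y; rewrite eT.
rewrite -[scalar_rank1 _ _ _ _]/((scalar_rank1 1 (s - 1) u \o
  scalar_rank1 1 (s - 1) u) y) scalar_rank1_comp// /scalar_rank1 mulr1 scale1r.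
rewrite addKr; congr (_ *: _).
by rewrite -[RHS](addKr 1) ex; ring.
Qed.

Lemma opsum_form u : ip (opsum w C u) u = \sum_(i < N) w i * ip u (C i u).
Proof. by rewrite ipC ip_sumr. Qed.

End RankOneSolutions.

End InnerProduct.

(** * Positive roots of the scalar equations *)

Section ScalarEquations.
Context {R : realType} {N : nat} {w : 'I_N -> R}.
Hypothesis hw : forall i, 0 < w i.

Lemma wsum_gt0P (a : 'I_N -> R) :
  0 < \sum_(i < N) w i * a i -> exists i, 0 < a i.
Proof.
move=> s0; apply: contrapT => nex; move: s0; rewrite ltNge => /negP; apply.
apply: sumr_le0 => i _; rewrite pmulr_rle0// leNgt; apply/negP => ai.
by apply: nex; exists i.
Qed.

Lemma wsum_gt0 (a : 'I_N -> R) : (forall i, 0 <= a i) ->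
  (exists i, 0 < a i) -> 0 < \sum_(i < N) w i * a i.
Proof.
move=> a0 [i ai]; rewrite (bigD1 i)//= ltr_pwDl ?mulr_gt0//.
by apply: sumr_ge0 => j _; rewrite mulr_ge0// ltW.
Qed.

Context {a : 'I_N -> R} {c : R}.
Hypotheses (ha : forall i, 0 <= a i) (hc : 0 < c).

(* The increment quotient [\sum_i w i * (sqrt (1 + c^2 x (a i)) - 1) / x], in
   the form that extends continuously to [x = 0]. *)
Let q (x : R) : R :=
  \sum_(i < N) w i * (c ^+ 2 * a i / (1 + Num.sqrt (1 + c ^+ 2 * (x * a i)))).

Let M : R := \sum_(i < N) w i * Num.sqrt (a i).

Lemma quot_continuous : continuous q.
Proof.
apply: continuous_big => [|i _] x; first exact: add_continuous.
apply: cvgMr; apply: cvgMr; apply: cvgV.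
  by rewrite gt_eqF// ltr_wpDr ?sqrtr_ge0.
apply: cvgD; first exact: cvg_cst.
suff : continuous (Num.sqrt \o (fun x => 1 + c ^+ 2 * (x * a i))) by apply.
move=> y; apply: continuous_comp; last exact: sqrt_continuous.
apply: cvgD; first exact: cvg_cst.
by apply: cvgMr; apply: cvgMl; exact: cvg_id.
Qed.

Lemma quot0 : q 0 = c ^+ 2 / 2 * \sum_(i < N) w i * a i.
Proof.
rewrite /q mulr_sumr; apply: eq_bigr => i _.
by rewrite mul0r mulr0 addr0 sqrtr1; field.
Qed.

(** Rationalisation: [(sqrt (1 + t) - 1) (sqrt (1 + t) + 1) = t]. *)
Lemma mul_quot x : 0 <= x ->
  x * q x = \sum_(i < N) w i * (Num.sqrt (1 + c ^+ 2 * (x * a i)) - 1).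
Proof.
move=> x0; rewrite /q mulr_sumr; apply: eq_bigr => i _.
have y0 : 0 <= 1 + c ^+ 2 * (x * a i) by rewrite addr_ge0 ?mulr_ge0// ltW.
have := sqr_sqrtr y0; have := sqrtr_ge0 (1 + c ^+ 2 * (x * a i)).
set s := Num.sqrt _ => s0 es; rewrite mulrCA; congr (_ * _).
have s1 : 1 + s != 0 by rewrite gt_eqF// ltr_wpDr.
by apply: (mulIf s1); rewrite mulrA divfK//; lra.
Qed.

(** Termwise [sqrt (1 + z^2) <= 1 + z] with [z = c r sqrt (a i)]. Thus [x q x] grows at most like
    [sqrt x], which makes the functions below nonpositive at a suitable large [x]. *)
Lemma mul_quot_le (r : R) : 0 <= r -> r ^+ 2 * q (r ^+ 2) <= c * r * M.
Proof.
move=> r0; rewrite mul_quot ?sqr_ge0// /M mulr_sumr; apply: ler_sum => i _.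
rewrite [leRHS]mulrCA ler_pM2l// lerBlDl.
have -> : c ^+ 2 * (r ^+ 2 * a i) = (c * r * Num.sqrt (a i)) ^+ 2.
  by rewrite !exprMn sqr_sqrtr// mulrA.
set z := c * r * _; have z0 : 0 <= z by rewrite !mulr_ge0 ?sqrtr_ge0// ltW.
rewrite -(ler_pXn2r (n := 2)) ?nnegrE ?sqrtr_ge0 ?addr_ge0//.
by rewrite sqr_sqrtr ?addr_ge0 ?sqr_ge0//; nra.
Qed.

(** The strict sign at 0 keeps the root given by the intermediate value theorem away from 0, hence
    from the trivial solution. *)
Lemma pos_root (g : R -> R) (b : R) : continuous g -> 0 < g 0 -> 0 < b ->
  g b <= 0 -> exists2 x, 0 < x & g x = 0.
Proof.
move=> cg g0 b0 gb.
have [||x] := @IVT R g 0 b 0 (ltW b0).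
- exact: continuous_subspaceT.
- by rewrite ge_min gb orbT le_max (ltW g0).
rewrite in_itv /= => /andP[x0 _] gx; exists x => //.
rewrite lt_neqAle x0 andbT; apply/eqP => x_eq0.
by move: g0 gx; rewrite -x_eq0 => + gx0; rewrite gx0 ltxx.
Qed.

Lemma wsum_sqrt_gt0 : 0 < \sum_(i < N) w i * a i -> 0 < M.
Proof.
move=> /wsum_gt0P[i ai]; apply: wsum_gt0 => [j|]; first exact: sqrtr_ge0.
by exists i; rewrite sqrtr_gt0.
Qed.

Lemma scalar_eq2 : 2 < c * \sum_(i < N) w i * a i ->
  exists2 x : R, 0 < x &
    c * x = \sum_(i < N) w i * (Num.sqrt (1 + c ^+ 2 * (x * a i)) - 1).
Proof.
move=> hS; have M0 : 0 < M.
  by apply: wsum_sqrt_gt0; rewrite -(pmulr_rgt0 _ hc); apply: lt_trans hS.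
(* The endpoint [M^2] comes from the growth bound at [r = M], namely [M^2 q (M^2) <= c M^2]. *)
have [||||x x0 gx] := @pos_root (fun x => q x - c) (M ^+ 2).
- move=> x; apply: cvgB; [exact: quot_continuous|exact: cvg_cst].
- rewrite /= quot0; set S := \sum_(_ < _) _ in hS *.
  (* The hypothesis is exactly positivity at 0. *)
  rewrite (_ : _ - c = c / 2 * (c * S - 2)); last by field.
  by rewrite !mulr_gt0 ?invr_gt0// subr_gt0.
- by rewrite exprn_gt0.
- rewrite -(pmulr_rle0 _ (exprn_gt0 2 M0)).
  have := @mul_quot_le M (ltW M0).
  by rewrite /= mulrBr subr_le0 -mulrA -expr2 [c * _]mulrC.
exists x => //; rewrite -mul_quot ?ltW// mulrC; congr (_ * _).
by apply/esym/eqP; rewrite -subr_eq0; exact/eqP.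
Qed.

Lemma scalar_eq3 : \sum_(i < N) w i = 1 -> 0 < \sum_(i < N) w i * a i ->
  exists2 x : R, 0 < x &
    1 + (c * x) ^+ 2 =
    (\sum_(i < N) w i * Num.sqrt (1 + c ^+ 2 * (x * a i))) ^+ 2.
Proof.
move=> hw1 hS; have M0 := wsum_sqrt_gt0 hS.
(* The weighted sum is [1 + x q x], so the equation reads [c^2 x^2 = x q x (x q x + 2)]; [g] is the
   difference of its sides divided by [x]. *)
pose g x := q x * (x * q x + 2) - c ^+ 2 * x.
(* The summand [c^-1] gives [c (r - M) >= 1], and the summand 1 gives [r >= M + 1]; together they
   yield [c r (r^2 - M^2) >= r (r + M) >= 2 M], hence [g (r^2) <= 0]. *)
pose r := M + 1 + c^-1; have ic0 : 0 < c^-1 by rewrite invr_gt0.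
have r0 : 0 < r by rewrite /r; lra.
have [||||x x0 gx] := @pos_root g (r ^+ 2).
- move=> x; apply: cvgB; last by apply: cvgMr; exact: cvg_id.
  apply: cvgM; first exact: quot_continuous.
  apply: cvgD; last exact: cvg_cst.
  by apply: cvgM; [exact: cvg_id|exact: quot_continuous].
- by rewrite /g mul0r mulr0 subr0 add0r quot0; have := exprn_gt0 2 hc; nra.
- by rewrite exprn_gt0.
- rewrite -(pmulr_rle0 _ (exprn_gt0 2 r0)) /g.
  set p := r ^+ 2 * q (r ^+ 2).
  have p0 : 0 <= p.
    rewrite /p mulr_ge0 ?sqr_ge0// sumr_ge0// => i _.
    rewrite mulr_ge0 ?(ltW (hw i))// divr_ge0 ?addr_ge0 ?sqrtr_ge0//.
    by rewrite mulr_ge0 ?sqr_ge0.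
  have ple : p <= c * r * M by apply: mul_quot_le; exact: ltW.
  rewrite mulrBr mulrA -/p subr_le0.
  apply: (@le_trans _ _ (c * r * M * (c * r * M + 2))).
    apply: ler_pM => //; first by rewrite addr_ge0.
    by rewrite lerD2r.
  rewrite -subr_ge0.
  rewrite (_ : _ - _ = c * r * (c * r * (r ^+ 2 - M ^+ 2) - 2 * M));
    last by ring.
  rewrite !mulr_ge0 ?(ltW hc) ?(ltW r0)// subr_ge0.
  have cr : 1 <= c * (r - M).
    rewrite (_ : r - M = 1 + c^-1); last by rewrite /r; ring.
    by rewrite mulrDr mulr1 mulfV ?lt0r_neq0// lerDr ltW.
  have rM : 1 <= r - M by rewrite /r; lra.
  have -> : c * r * (r ^+ 2 - M ^+ 2) = (c * (r - M)) * (r * (r + M)) by ring.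
  have r1 : 1 <= r by lra.
  have h : 2 * M <= r * (r + M) by nra.
  by apply: (le_trans h); rewrite ler_peMl// mulr_ge0//; lra.
exists x => //.
rewrite (_ : \sum_(i < N) w i * _ = \sum_(i < N) w i + x * q x); last first.
  by rewrite mul_quot ?ltW// -big_split /=; apply: eq_bigr => i _; ring.
rewrite hw1; have : x * g x = 0 by rewrite gx mulr0.
by rewrite /g; nra.
Qed.

End ScalarEquations.

(** * Assembly of the solution families *)

Theorem mainTheorem14 (R : realType) (H : completeNormedModType R)
  (ip : H -> H -> R) (hH : is_real_sep_hilbert ip) (hdim : dim_ge2 ip)
  (N : nat) (C : 'I_N -> H -> H) (hC : forall i, SymPos ip (C i))
  (w : 'I_N -> R) (hw : forall i, 0 < w i) (hw1 : \sum_(i < N) w i = 1)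
  (eps : R) (heps : 0 < eps) :
  let c := 4 / eps in
  let S := opsum w C in
  (* ---------- equation (1) ---------- *)
  [/\ [/\ (forall u : H, unit_vec ip u ->
         0 < \sum_(i < N) w i * Num.sqrt (ip u (C i u)) ->
         eq1 ip w C (fun x => (\sum_(i < N) w i * Num.sqrt (ip u (C i u))) ^+ 2
                                *: rank1 ip u x)),
      (strictly_pos ip S ->
         ~ countable [set X | pos_singular ip X /\ eq1 ip w C X]) &
      ((exists i, C i <> @zeroop R H) ->
         exists X, pos_singular ip X /\ eq1 ip w C X)],
  (* ---------- equation (2) ---------- *)
      ((forall u : H, unit_vec ip u ->
         eps < 2 * \sum_(i < N) w i * ip u (C i u) ->
         exists xu : R, 0 < xu /\ eq2 ip w C c (fun x => xu *: rank1 ip u x)) /\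
        (finite_dim H ->
         strictly_pos ip (fun x => 2 *: S x - eps *: x) ->
         ~ countable [set X | pos_singular ip X /\ eq2 ip w C c X])) &
  (* ---------- equation (3) ---------- *)
      [/\ (forall u : H, unit_vec ip u ->
             0 < \sum_(i < N) w i * ip u (C i u) ->
             exists xu : R, 0 < xu /\ eq3 ip w C c (fun x => xu *: rank1 ip u x)),
          (strictly_pos ip S ->
             ~ countable [set X | pos_singular ip X /\ eq3 ip w C c X]) &
          ((exists i, C i <> @zeroop R H) ->
             exists X, pos_singular ip X /\ eq3 ip w C c X)]].
Proof.
move=> c S.
have c0 : 0 < c by rewrite divr_gt0.
have a_ge0 u i : 0 <= ip u (C i u) := SymPos_form_ge0 hH hC i u.
have sqrt_sum_gt0 u : 0 < \sum_(i < N) w i * ip u (C i u) ->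
    0 < \sum_(i < N) w i * Num.sqrt (ip u (C i u)).
  exact: wsum_sqrt_gt0.
have sol1 u : unit_vec ip u ->
    0 < \sum_(i < N) w i * Num.sqrt (ip u (C i u)) ->
    exists2 x : R, 0 < x & eq1 ip w C (fun y => x *: rank1 ip u y).
  move=> hu s0; exists ((\sum_(i < N) w i * Num.sqrt (ip u (C i u))) ^+ 2).
    exact: exprn_gt0.
  by apply: eq1_rank1 => //; exact: ltW.
have sol2 u : unit_vec ip u -> eps < 2 * \sum_(i < N) w i * ip u (C i u) ->
    exists2 x : R, 0 < x & eq2 ip w C c (fun y => x *: rank1 ip u y).
  move=> hu hS; have [|x x0 ex] := scalar_eq2 hw (a_ge0 u) c0.
    (* As [c = 4 / eps], the condition [eps < 2 s] on the weighted sum [s] is [2 < c s]. *)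
    by rewrite /c mulrAC ltr_pdivlMr//; lra.
  by exists x => //; apply: eq2_rank1 => //; exact: ltW.
have sol3 u : unit_vec ip u -> 0 < \sum_(i < N) w i * ip u (C i u) ->
    exists2 x : R, 0 < x & eq3 ip w C c (fun y => x *: rank1 ip u y).
  move=> hu hS; have [x x0 ex] := scalar_eq3 hw (a_ge0 u) c0 hw1 hS.
  by exists x => //; apply: eq3_rank1 => //; exact: ltW.
have S_gt0 u : strictly_pos ip S -> unit_vec ip u ->
    0 < \sum_(i < N) w i * ip u (C i u).
  move=> hS hu; rewrite -(@opsum_form _ _ _ hH N w C); apply: hS.
  exact: (unit_vec_neq0 hH).
have nonzero_gt0 : (exists i, C i <> @zeroop R H) ->
    exists2 u, unit_vec ip u & 0 < \sum_(i < N) w i * ip u (C i u).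
  (* One nonzero [C i] is positive at some unit [u], and the other terms of the weighted sum are
     nonnegative there. *)
  move=> [i Ci0]; have [u hu ui] := SymPos_form_gt0 hH (hC i) Ci0.
  by exists u => //; apply: wsum_gt0 => //; exists i.
split; last split.
- split.
  + by move=> u hu s0; apply: eq1_rank1 => //; exact: ltW.
  + move=> hS; apply: (uncountable_rank1 hH) => // u hu.
    by apply: sol1 => //; apply: sqrt_sum_gt0; exact: S_gt0.
  + move=> /nonzero_gt0[u hu su].
    have [x x0 ex] := sol1 u hu (sqrt_sum_gt0 u su).
    by exists (fun y => x *: rank1 ip u y); split => //;
      exact: rank1_pos_singular.
- split=> [u hu su|_ hS]; first by have [x x0 ex] := sol2 u hu su; exists x.
  apply: (uncountable_rank1 hH) => // u hu; apply: sol2 => //.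
  have := hS u (unit_vec_neq0 hH hu).
  by rewrite (ipDl hH) (ipNl hH) !(ipZl hH) opsum_form// hu mulr1 subr_gt0.
- by move=> u hu su; have [x x0 ex] := sol3 u hu su; exists x.
- move=> hS; apply: (uncountable_rank1 hH) => // u hu.
  by apply: sol3 => //; exact: S_gt0.
- move=> /nonzero_gt0[u hu su]; have [x x0 ex] := sol3 u hu su.
  by exists (fun y => x *: rank1 ip u y); split => //;
      exact: rank1_pos_singular.
Qed.
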